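(* Let $P$ be a hull configuration of $n$ points. Then there is a one-to-one correspondence between the maximal Boolean subposets of $\textsc{NC}(P)$ (subsets of $\textsc{NC}(P)$ which, with the induced order, are isomorphic to the Boolean lattice $\textsc{Bool}(n-1)$ of all subsets of an $(n-1)$-element set) and the noncrossing trees on $P$ with convex geodesics.
   Context: A configuration is a finite set $P$ of $n$ distinct points in the plane. $P$ is a hull configuration if either its convex hull $\textsc{Conv}(P)$ is one-dimensional or no point of $P$ lies in the interior of $\textsc{Conv}(P)$. A set partition of $P$ is noncrossing if the convex hulls of its blocks are pairwise disjoint; $\textsc{NC}(P)$ is the poset of noncrossing partitions of $P$ ordered by refinement. A noncrossing forest on $P$ is a graph without cycles embedded in the plane, with vertex set $P$ and straight-line-segment edges, where edges meet only at common endpoints; a noncrossing tree is a connected noncrossing forest. A noncrossing forest $\mu$ on $P$ has convex geodesics if for every subtree $\tau\subseteq\mu$, the only points of $P$ in the convex hull of $\tau$ are the vertices of $\tau$ (equivalently, for any two vertices $x,y$ in the same component of $\mu$, the convex hull of the unique path from $x$ to $y$ in $\mu$ contains only those points of $P$ lying on that path). *)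

(* Defs.v *)
From HB Require Import structures.
From mathcomp Require Import all_boot all_order all_algebra finmap.
From mathcomp Require Import all_classical all_reals all_analysis.

Set Implicit Arguments.
Unset Strict Implicit.
Unset Printing Implicit Defensive.

Import Order.TTheory GRing.Theory Num.Theory numFieldNormedType.Exports.

Local Open Scope classical_set_scope.
Local Open Scope ring_scope.

Section Geometry.
Variable R : realType.
Local Notation plane := ('rV[R]_2).
Implicit Types (A : set plane) (P : {fset plane}).

Definition conv_hull A : set plane := smallest (@convex_set R plane) A.

Definition one_dimensional A : Prop :=
  (exists x y : plane, [/\ A x, A y & x != y]) /\
  (exists p v : plane, v != 0 /\ A `<=` [set p + t *: v | t in [set: R]]).

(* The interior is the topological one, taken in the plane. *)
Definition hull_configuration P : Prop :=
  one_dimensional (conv_hull [set` P]) \/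
  (forall p : plane, p \in P -> ~ interior (conv_hull [set` P]) p).

End Geometry.

Section Graphs.
Variable V : finType.
Implicit Types (S : {set V}) (E F : {set {set V}}) (x y : V).

(* A simple graph is a vertex set together with a set of two-element subsets
   of it. *)
Definition is_graph S E : Prop :=
  forall e : {set V}, e \in E -> #|e| = 2%N /\ e \subset S.

Definition adj E : rel V := fun x y => [set x; y]%SET \in E.

(* [ucycle] traverses a single edge back and forth as a cycle of size 2. *)
Definition acyclic E : Prop :=
  forall c : seq V, ucycle (adj E) c -> (size c <= 2)%N.

Definition is_forest S E : Prop := is_graph S E /\ acyclic E.

Definition is_tree S E : Prop :=
  [/\ is_forest S E, S != finset.set0
    & {in S &, forall x y, connect (adj E) x y}].

Definition subtree S F E : Prop := F \subset E /\ is_tree S F.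

End Graphs.

Section NoncrossingPartitions.
Variables (R : realType) (P : {fset 'rV[R]_2}).
Implicit Types (S A B : {set P}) (pi sigma : {set {set P}}).

Definition points S : set 'rV[R]_2 := [set val x | x in [set` S]].

Definition noncrossing_partition pi : Prop :=
  finset.partition pi [set: P]%SET /\
  {in pi &, forall A B, A != B ->
     conv_hull (points A) `&` conv_hull (points B) = set0}.

Definition NC : set {set {set P}} := [set pi | noncrossing_partition pi].

Definition refines pi sigma : Prop :=
  forall A, A \in pi -> exists2 B, B \in sigma & A \subset B.

(* The subsets of NC(P) that are isomorphic, in the induced order, to the
   lattice of subsets of an m-element set. *)
Definition Boolean_subposet (m : nat) (Q : {set {set {set P}}}) : Prop :=
  [set` Q] `<=` NC /\
  exists f : {set 'I_m} -> {set {set P}},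
    set_bij [set: {set 'I_m}] [set` Q] f /\
    (forall X Y : {set 'I_m}, X \subset Y <-> refines (f X) (f Y)).


End NoncrossingPartitions.

Section NoncrossingTrees.
Variables (R : realType) (P : {fset 'rV[R]_2}).
Implicit Types (S e f : {set P}) (E F : {set {set P}}) (x : P).

(* For an edge e = {x, y} this is the line segment [x, y]. *)
Definition edge_segment e : set 'rV[R]_2 := conv_hull (points e).

(* Besides edges meeting only at common endpoints, a plane embedding requires
   that no vertex lies on an edge of which it is not an endpoint. *)
Definition noncrossing_graph E : Prop :=
  {in E &, forall e f, e != f ->
     edge_segment e `&` edge_segment f `<=` points (e :&: f)%SET} /\
  (forall e x, e \in E -> edge_segment e (val x) -> x \in e).

Definition noncrossing_forest E : Prop :=
  is_forest [set: P]%SET E /\ noncrossing_graph E.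

Definition noncrossing_tree E : Prop :=
  noncrossing_forest E /\ is_tree [set: P]%SET E.

Definition drawing S F : set 'rV[R]_2 :=
  points S `|` \bigcup_(e in [set` F]) edge_segment e.

Definition convex_geodesics E : Prop :=
  forall S F, subtree S F E ->
    forall x, conv_hull (drawing S F) (val x) -> x \in S.

End NoncrossingTrees.

(* Main.v *)
Require Import Defs.
From HB Require Import structures.
From mathcomp Require Import all_boot all_order all_algebra finmap.
From mathcomp Require Import all_classical all_reals all_analysis.
From mathcomp Require Import ring lra.

(* A tree E is sent to the set of the component partitions of its subgraphs.

   Conversely, comparing numbers of blocks shows that an order embedding f of
   Bool(n-1) into the partitions of n points satisfies #|f X| = n - #|X|. Hence
   f {i} has a single nontrivial block, an edge e_i, and by induction on X the
   partition f X consists of the components of {e_i : i in X}. The e_i form a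
   tree, and the noncrossing condition on the f X makes this tree noncrossing
   with convex geodesics, for any configuration.

   The hull hypothesis is needed to see that disjoint subtrees with vertex sets
   S and T of a noncrossing tree with convex geodesics have disjoint hulls. If
   the hulls meet, then (Kirchberger) either a vertex of one lies in the hull of
   the other, which convex geodesics forbid, or a segment aa' of S properly
   crosses a segment bb' of T. The path from a to a' crosses the line bb', and
   must do so between b and b': otherwise b or b' would be interior to the hull.
   So an edge of S crosses bb' and, in turn, an edge of T crosses that edge. *)

Set Implicit Arguments.
Unset Strict Implicit.
Unset Printing Implicit Defensive.

Local Open Scope classical_set_scope.
Local Open Scope ring_scope.

(** * Partitions into connected components *)

Section Components.
Import mathcomp.boot.fintype mathcomp.boot.finset.
Local Open Scope nat_scope.
Local Open Scope set_scope.
Variable V : finType.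
Implicit Types (pi sigma : {set {set V}}) (A B : {set V}) (E F : {set {set V}}).
Implicit Types (x y z u v : V).

(** This is [refines] over an arbitrary finite type. On [P] the two are convertible, so the lemmas
    below apply to [NC]. *)
Definition finer pi sigma : Prop :=
  forall A, A \in pi -> exists2 B, B \in sigma & A \subset B.

Lemma connect_inv (e : rel V) (Q : V -> Prop) x y :
  Q x -> (forall u v, Q u -> e u v -> Q v) -> connect e x y -> Q y.
Proof.
move=> Qx Qe /connectP[p pP ->{y}].
elim: p x Qx pP => //= z p IHp x Qx /andP[xz zp].
by apply: IHp zp; apply: Qe xz.
Qed.

Lemma in_pblock_refl pi x : partition pi [set: V] -> x \in pblock pi x.
Proof. by move=> piP; rewrite mem_pblock (cover_partition piP) inE. Qed.

Lemma pblock_partition pi x : partition pi [set: V] -> pblock pi x \in pi.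
Proof. by move=> piP; rewrite pblock_mem // (cover_partition piP) inE. Qed.

Lemma pblock_eq pi A x : partition pi [set: V] -> A \in pi -> x \in A ->
  pblock pi x = A.
Proof. by case/and3P=> _ tiP _; apply: def_pblock. Qed.

Lemma finer_pblock pi sigma x : partition pi [set: V] ->
  partition sigma [set: V] -> finer pi sigma -> pblock pi x \subset pblock sigma x.
Proof.
move=> piP sP fin; have [B Bs AB] := fin _ (pblock_partition x piP).
by rewrite (pblock_eq sP Bs) // (subsetP AB) // in_pblock_refl.
Qed.

Lemma pblock_finer pi sigma : partition pi [set: V] ->
  partition sigma [set: V] ->
  (forall x y, y \in pblock pi x -> y \in pblock sigma x) -> finer pi sigma.
Proof.
move=> piP sP fin A Api.
have [x xA] : exists x, x \in A by apply/set0Pn/(partition_neq0 piP).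
exists (pblock sigma x); first exact: pblock_partition.
by apply/subsetP=> y yA; apply: fin; rewrite (pblock_eq piP Api).
Qed.

Lemma finer_refl pi : finer pi pi.
Proof. by move=> A piA; exists A. Qed.

Lemma finer_anti pi sigma : partition pi [set: V] -> partition sigma [set: V] ->
  finer pi sigma -> finer sigma pi -> pi = sigma.
Proof.
move=> piP sP ps sp.
have E x : pblock pi x = pblock sigma x.
  by apply/eqP; rewrite eqEsubset !finer_pblock.
rewrite -(equivalence_partition_pblock piP) -(equivalence_partition_pblock sP).
by apply: eq_in_imset => x _; apply/setP=> y; rewrite !inE E.
Qed.

(** When [A] is a block of a refinement of [sigma], all terms of the union coincide with the block
    of [sigma] around [A]. The union avoids choosing a point of [A]. *)
Definition merge_block sigma A := \bigcup_(x in A) pblock sigma x.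

Lemma merge_blockE pi sigma A x : partition pi [set: V] ->
  partition sigma [set: V] -> finer pi sigma -> A \in pi -> x \in A ->
  merge_block sigma A = pblock sigma x.
Proof.
move=> piP sP fin Api xA; have [B Bs AB] := fin _ Api.
rewrite (pblock_eq sP Bs) ?(subsetP AB) //; apply/eqP; rewrite eqEsubset.
apply/andP; split.
  by apply/bigcupsP=> y yA; rewrite (pblock_eq sP Bs) ?(subsetP AB).
by rewrite -{1}(pblock_eq sP Bs (subsetP AB x xA)); apply: bigcup_sup.
Qed.

Lemma merge_block_imset pi sigma : partition pi [set: V] ->
  partition sigma [set: V] -> finer pi sigma -> merge_block sigma @: pi = sigma.
Proof.
move=> piP sP fin; apply/setP=> B; apply/imsetP/idP => [[A Api ->]|Bs].
  have [x xA] : exists x, x \in A by apply/set0Pn/(partition_neq0 piP).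
  by rewrite (merge_blockE piP sP fin Api xA) pblock_partition.
have [x xB] : exists x, x \in B by apply/set0Pn/(partition_neq0 sP).
exists (pblock pi x); first exact: pblock_partition.
rewrite (merge_blockE (x := x) piP sP fin) ?pblock_partition ?in_pblock_refl //.
by rewrite (pblock_eq sP Bs).
Qed.

Lemma finer_card pi sigma : partition pi [set: V] ->
  partition sigma [set: V] -> finer pi sigma -> #|sigma| <= #|pi|.
Proof. by move=> piP sP /(merge_block_imset piP sP) <-; apply: leq_imset_card. Qed.

(** The map [merge_block sigma] sends [pi] onto [sigma]. If the number of blocks does not drop, it
    is injective, so no two blocks of [pi] are merged and [sigma] refines [pi] as well. *)
Lemma finer_card_eq pi sigma : partition pi [set: V] ->
  partition sigma [set: V] -> finer pi sigma -> #|pi| <= #|sigma| -> pi = sigma.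
Proof.
move=> piP sP fin lecard; apply: (finer_anti piP sP fin).
have /imset_injP inj : #|merge_block sigma @: pi| == #|pi|.
  by rewrite eqn_leq leq_imset_card (merge_block_imset piP sP fin).
apply: (pblock_finer sP piP) => x y yx.
suff -> : pblock pi x = pblock pi y by apply: in_pblock_refl.
apply: inj; rewrite ?pblock_partition //.
rewrite !(merge_blockE piP sP fin (pblock_partition _ piP) (in_pblock_refl _ piP)).
by rewrite (pblock_eq sP (pblock_partition x sP) yx).
Qed.

(** * Connected components of a graph *)

Lemma adj_sym E : symmetric (adj E).
Proof. by move=> x y; rewrite /adj setUC. Qed.

Lemma connect_adj_sym E x y : connect (adj E) x y = connect (adj E) y x.
Proof. exact/sym_connect_sym/adj_sym. Qed.

Lemma connect_adjS E F x y :
  E \subset F -> connect (adj E) x y -> connect (adj F) x y.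
Proof.
move=> EF; apply: connect_sub => u v uv; apply: connect1.
exact: (subsetP EF).
Qed.

Definition component E x := [set y | connect (adj E) x y].

Lemma mem_component E x : x \in component E x.
Proof. by rewrite inE connect0. Qed.

Definition components E : {set {set V}} := [set component E x | x in [set: V]].

Lemma mem_components E x : component E x \in components E.
Proof. by apply/imsetP; exists x. Qed.

Lemma componentsE E :
  components E = equivalence_partition (connect (adj E)) [set: V].
Proof. by apply: eq_in_imset => x _; apply/setP=> y; rewrite !inE. Qed.

Lemma connect_adj_equiv E : {in [set: V] & &, equivalence_rel (connect (adj E))}.
Proof.
move=> x y z _ _ _; split=> [|xy]; first exact: connect0.
exact: (same_connect (sym_connect_sym (@adj_sym E))).
Qed.

Lemma components_partition E : partition (components E) [set: V].
Proof. rewrite componentsE; apply/equivalence_partitionP/connect_adj_equiv. Qed.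
Hint Resolve components_partition : core.

Lemma pblock_components E x : pblock (components E) x = component E x.
Proof.
exact: (pblock_eq (components_partition E) (mem_components E x)
  (mem_component E x)).
Qed.

Lemma component_eq E x y :
  connect (adj E) x y -> component E x = component E y.
Proof.
move=> xy; apply/setP=> z; rewrite !inE.
exact: (same_connect (sym_connect_sym (@adj_sym E))).
Qed.

(** Blocks that absorb edges absorb paths. This is the universal property of [components E]: it is
    the finest partition keeping the ends of every edge together. *)
Lemma components_finer E sigma : partition sigma [set: V] ->
  (forall x y, adj E x y -> y \in pblock sigma x) <-> finer (components E) sigma.
Proof.
move=> sP; split=> [H|fin x y xy].
  apply: pblock_finer => // x y; rewrite pblock_components inE.
  apply: (connect_inv (Q := fun y => y \in pblock sigma x)).
    exact: in_pblock_refl.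
  move=> u v ux /H; suff -> : pblock sigma u = pblock sigma x by [].
  exact: (pblock_eq sP (pblock_partition x sP) ux).
apply: (subsetP (finer_pblock x (components_partition E) sP fin)).
by rewrite pblock_components inE connect1.
Qed.

Lemma components_finerP E F :
  (forall x y, adj E x y -> connect (adj F) x y) <->
  finer (components E) (components F).
Proof.
split=> [H|/(components_finer E (components_partition F)) H x y /H].
  apply/(components_finer E (components_partition F)) => x y /H xy.
  by rewrite pblock_components inE.
by rewrite pblock_components inE.
Qed.

Lemma components_mono E F : E \subset F -> finer (components E) (components F).
Proof.
move=> EF; apply/components_finerP => x y xy.
by apply/connect1/(subsetP EF).
Qed.

(** Induction along the walk with the disjunction as invariant: the new edge is avoided, crossed
    from [x] to [y], or crossed from [y] to [x]. *)
Lemma connect_addE E x y u v : connect (adj ([set x; y] |: E)) u v ->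
  [|| connect (adj E) u v, connect (adj E) u x && connect (adj E) y v |
      connect (adj E) u y && connect (adj E) x v].
Proof.
apply: (connect_inv (Q := fun v => is_true [|| connect (adj E) u v,
  connect (adj E) u x && connect (adj E) y v |
      connect (adj E) u y && connect (adj E) x v])).
  by rewrite connect0.
move=> {}v w H; rewrite /adj !inE => /orP[/eqP vw|vw].
  have vxy : v \in [set x; y] by rewrite -vw !inE eqxx.
  have wxy : w \in [set x; y] by rewrite -vw !inE eqxx orbT.
  move: vxy wxy H; rewrite !inE => /pred2P[] -> /pred2P[] ->;
    rewrite ?connect0 ?andbT; case: (connect _ u x); case: (connect _ u y) => //=;
    by rewrite ?orbT.
have trans a : connect (adj E) a v -> connect (adj E) a w.
  by move=> av; apply: connect_trans av (connect1 _).
by case/or3P: H => [/trans->|/andP[-> /trans->]|/andP[-> /trans->]] //;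
  rewrite ?orbT.
Qed.

(** At least one merging occurs, since equal counts would make the two partitions equal. At most one
    occurs, since [merge_block] is injective once the component of [y] is left out. *)
Lemma card_components_add E x y : ~~ connect (adj E) x y ->
  #|components E| = #|components ([set x; y] |: E)|.+1.
Proof.
set E' := _ |: E => nxy.
have EE' : E \subset E' by apply: subsetUr.
have fin := components_mono EE'.
apply/eqP; rewrite eqn_leq; apply/andP; split; last first.
  rewrite ltnNge; apply/negP=> le.
  have := finer_card_eq (components_partition E) (components_partition E') fin le.
  move/(congr1 (fun pi => y \in pblock pi x)).
  rewrite !pblock_components !inE (negbTE nxy) => /esym/negP; apply.
  by apply: connect1; rewrite /adj !inE eqxx.
rewrite (cardsD1 (component E y)) mem_components add1n ltnS.
have /card_in_imset <- : {in components E :\ component E y &,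
    injective (merge_block (components E'))}.
  move=> A B /setD1P[Ay /imsetP[u _ Au]] /setD1P[By /imsetP[v _ Bv]].
  rewrite {A}Au {B}Bv in Ay By *.
  have mE z := merge_blockE (components_partition E) (components_partition E')
    fin (mem_components E z) (mem_component E z).
  rewrite !mE !pblock_components => /setP/(_ v).
  rewrite mem_component inE => /connect_addE/or3P[/component_eq//||] /andP[].
    by move=> _ yv; rewrite (component_eq yv) eqxx in By.
  by move=> uy; rewrite (component_eq uy) eqxx in Ay.
set D := _ :\ _; have DE : D \subset components E by apply: subD1set.
have := subset_leq_card (imsetS (merge_block (components E')) DE).
by rewrite (merge_block_imset (components_partition E) (components_partition E')).
Qed.

Lemma component0 x : component set0 x = [set x].
Proof.
apply/setP=> y; rewrite !inE; apply/idP/eqP => [|->]; last exact: connect0.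
by apply: (connect_inv (Q := fun y => y = x)) => // u v _; rewrite /adj inE.
Qed.

Lemma card_components0 : #|components set0| = #|V|.
Proof.
rewrite card_imset ?cardsT // => x y.
by rewrite !component0 => /set1_inj.
Qed.

(** * Forests as graphs in which every edge is a bridge *)

Definition bridged E := forall x y, adj E x y ->
  ~~ connect (adj (E :\ [set x; y])) x y.

Lemma bridgedS E F : F \subset E -> bridged E -> bridged F.
Proof.
move=> FE bE x y xy; apply: contra (bE x y (subsetP FE _ xy)).
by apply: connect_adjS; apply: setSD.
Qed.

(** A simple path joining the ends of an edge without using it closes up to a cycle of size at least
    3. Conversely, such a cycle without its first edge still joins the ends of that edge. The bridge
    form allows edges to be removed one at a time while components are counted. *)
Lemma acyclicP E : is_graph [set: V] E -> acyclic E <-> bridged E.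
Proof.
move=> gE; split=> [acE x y xy|bE c].
  apply/negP=> /connectP[p0 p0P ylast]; case/shortenP: p0P ylast => p pP up _ ylast.
  have /acE : ucycle (adj E) (x :: p).
    apply/andP; split=> //=; rewrite rcons_path -ylast adj_sym xy andbT.
    by apply: sub_path pP => u v; rewrite /adj inE => /andP[].
  case: p pP ylast {up} => [_ /= exy|z [|//] /= + ezy _].
    by have [] := gE _ xy; rewrite exy setUid cards1.
  by rewrite -ezy /adj !inE eqxx.
case: c => [|x [|y [|z q]]] // /andP[/= /and3P[xy yz]].
move=> zq; rewrite !inE !negb_or => /andP[/and3P[nxy nxz nxq]].
case/andP=> /andP[nyz nyq] _; exfalso.
have /negP[] := bE _ _ xy; rewrite connect_adj_sym.
apply: (@connect_trans _ _ z).
  apply: connect1; rewrite /adj !inE (yz : _ \in E) andbT.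
  apply/eqP=> /setP/(_ x); rewrite !inE eqxx (negbTE nxy) /=.
  by rewrite (negbTE nxz).
apply/connectP; exists (rcons q x); last by rewrite last_rcons.
(* The rest of the cycle, from [z] back to [x], never visits [y] and hence does not use the edge
   between [x] and [y]. *)
apply: (sub_in_path (P := predC1 y)) zq => [u v uy vy uv|].
  rewrite /adj !inE in uy vy *; rewrite (uv : _ \in E) andbT.
  apply/eqP=> /setP/(_ y); rewrite !inE eqxx orbT.
  by rewrite (eq_sym y u) (eq_sym y v) (negbTE uy) (negbTE vy).
rewrite /= all_rcons /= eq_sym nyz nxy /=.
by apply/allP=> w wq /=; apply: contraNneq nyq => <-.
Qed.


(** Removing a bridge creates exactly one new component; once all edges are gone the components are
    the single vertices. *)
Lemma card_bridged E : is_graph [set: V] E -> bridged E ->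
  #|components E| + #|E| = #|V|.
Proof.
have [k] := ubnP #|E|; elim: k E => // k IHk E leEk gE bE.
have [->|/set0Pn[e eE]] := eqVneq E set0.
  by rewrite card_components0 cards0 addn0.
have [/eqP/cards2P[x [y [xy eE']]] _] := gE _ eE.
have := card_components_add (bE x y _); rewrite /adj -eE' => /(_ eE).
rewrite (setD1K eE) (cardsD1 e E) eE add1n addnS -addSn => <-.
apply: IHk; first by move: leEk; rewrite (cardsD1 e) eE.
  by move=> e' /setD1P[_ /gE].
by apply: bridgedS bE; apply: subD1set.
Qed.

(** If an edge of [F] were missing from [F'], its ends would be joined by [F'], hence by [E] without
    that edge, which is a bridge. This makes passing to components an order embedding on the subsets
    of [E]. *)
Lemma bridged_finer E F F' : is_graph [set: V] E -> bridged E ->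
  F \subset E -> F' \subset E ->
  finer (components F) (components F') -> F \subset F'.
Proof.
move=> gE bE FE F'E /components_finerP fin; apply/subsetP=> e eF.
have eE := subsetP FE _ eF.
have [/eqP/cards2P[x [y [xy eE']]] _] := gE _ eE.
apply: contraT => eF'; have /negP[] : ~~ connect (adj (E :\ e)) x y.
  by rewrite eE'; apply: bE; rewrite /adj -eE'.
apply: (connect_adjS (E := F')); last by apply: fin; rewrite /adj -eE'.
apply/subsetP=> e' e'F'; rewrite !inE (subsetP F'E) // andbT.
by apply: contraNneq eF' => <-.
Qed.

(** A path of [F] starting at [x] stays in the component, so all its edges survive the restriction
    of [F]. *)
Lemma component_tree E F x : is_graph [set: V] E -> bridged E -> F \subset E ->
  subtree (component F x) [set e in F | e \subset component F x] E.
Proof.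
move=> gE bE FE; set B := component F x; set FB := [set _ in _ | _].
have FBE : FB \subset E.
  by apply: subset_trans FE; apply/subsetP=> e; rewrite inE => /andP[].
have gB : is_graph [set: V] FB by move=> e /(subsetP FBE)/gE.
have cx y : y \in B -> connect (adj FB) x y.
  rewrite inE.
  apply: (connect_inv (Q := fun y => is_true (connect (adj FB) x y))) => // u v xu uv.
  have xu' : connect (adj F) x u.
    by apply: connect_adjS xu; apply/subsetP=> e; rewrite inE => /andP[].
  apply: connect_trans xu (connect1 _).
  rewrite /adj inE (uv : _ \in F) /= subUset !sub1set !inE xu' /=.
  exact: connect_trans xu' (connect1 uv).
split=> //; split.
- split; last by apply/acyclicP => //; apply: bridgedS bE.
  by move=> e eB; have [-> _] := gB _ eB; move: eB; rewrite inE => /andP[].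
- by apply/set0Pn; exists x; rewrite inE connect0.
- move=> y z /cx xy /cx; apply: connect_trans.
  by rewrite connect_adj_sym.
Qed.

Lemma component_subtree E S F x : subtree S F E -> x \in S ->
  component F x = S.
Proof.
move=> [FE [[gF _] _ cS]] xS; apply/setP=> y; rewrite inE.
apply/idP/idP=> [|yS]; last exact: cS.
apply: (connect_inv (Q := fun y => y \in S)) => // u v _ /gF[_].
by rewrite subUset !sub1set => /andP[].
Qed.

(** Together with [component_subtree]: for a subtree with vertex set [S] and edge set [F], the
    blocks of [components F] are [S] and singletons. *)
Lemma component_subtree_out E S F x : subtree S F E -> x \notin S ->
  component F x = [set x].
Proof.
move=> [FE [[gF _] _ cS]] xS; apply/setP=> y; rewrite !inE.
apply/idP/eqP=> [|->]; last exact: connect0.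
apply: (connect_inv (Q := fun y => y = x)) => // u v -> /gF[_].
by rewrite subUset !sub1set (negbTE xS).
Qed.

Lemma pair_finer sigma x y : partition sigma [set: V] ->
  y \in pblock sigma x -> finer (components [set [set x; y]]) sigma.
Proof.
move=> sP yx; apply/components_finer => // u v; rewrite /adj inE => /eqP uv.
have sub : [set u; v] \subset pblock sigma x.
  by rewrite uv subUset !sub1set yx in_pblock_refl.
move: sub; rewrite subUset !sub1set => /andP[ux vx].
by rewrite (pblock_eq sP (pblock_partition x sP) ux).
Qed.

Lemma card_tree E : is_tree [set: V] E -> #|E| = #|V|.-1.
Proof.
move=> [[gE /(acyclicP gE) bE] /set0Pn[x _] cE].
rewrite -(card_bridged gE bE).
suff -> : components E = [set component E x] by rewrite cards1.
apply/setP=> B; rewrite inE; apply/imsetP/eqP=> [[y _ ->]|->]; last by exists x.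
by apply: component_eq; apply: cE.
Qed.

(** * Order embeddings of a Boolean lattice into the set partitions *)

Section BooleanEmbedding.
Variables (m : nat) (f : {set 'I_m} -> {set {set V}}).
Hypothesis cardV : #|V| = m.+1.
Hypothesis fP : forall X, partition (f X) [set: V].
Hypothesis f_finer : forall X Y : {set 'I_m}, X \subset Y <-> finer (f X) (f Y).

Lemma card_embed_lt (X Y : {set 'I_m}) :
  X \subset Y -> ~~ (Y \subset X) -> #|f Y| < #|f X|.
Proof.
move=> /f_finer XY; apply: contraR; rewrite -leqNgt => le; apply/f_finer.
by rewrite (finer_card_eq (fP X) (fP Y) XY le); apply: finer_refl.
Qed.

Lemma finer_components0 pi : partition pi [set: V] -> finer (components set0) pi.
Proof. by move=> piP; apply/components_finer => // x y; rewrite /adj inE. Qed.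

(** Removing the elements of [X] one by one gains a block each time, and there are never more than
    [m.+1] blocks. *)
Lemma card_embed_addl (X : {set 'I_m}) : #|f X| + #|X| <= m.+1.
Proof.
have [k] := ubnP #|X|; elim: k X => // k IHk X leXk.
have [->|/set0Pn[i iX]] := eqVneq X set0.
  rewrite cards0 addn0 -cardV -card_components0.
  by apply: finer_card => //; apply: finer_components0.
have /IHk : #|X :\ i| < k by move: leXk; rewrite (cardsD1 i) iX.
apply: leq_trans; rewrite (cardsD1 i X) iX addnCA add1n -addSn leq_add2r.
apply: card_embed_lt; first exact: subD1set.
by apply/subsetPn; exists i => //; rewrite !inE eqxx.
Qed.

(** Adding the missing elements one by one loses a block each time, and at least one block is left
    at the full set. *)
Lemma card_embed_addr (X : {set 'I_m}) : m.+1 <= #|f X| + #|X|.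
Proof.
have [k] := ubnP #|~: X|; elim: k X => // k IHk X leXk.
have [eX|/set0Pn[i iX]] := eqVneq (~: X) set0.
  have -> : #|X| = m by rewrite -[X]setCK eX setC0 cardsT card_ord.
  rewrite -add1n leq_add2r card_gt0; apply/set0Pn.
  have [x _] : exists x : V, x \in V by apply/card_gt0P; rewrite cardV.
  by exists (pblock (f X) x); apply: pblock_partition.
have niX : i \notin X by move: iX; rewrite inE.
have /IHk/leq_trans : #|~: (i |: X)| < k.
  by move: leXk; rewrite (cardsD1 i) iX setCU setIC -setDE.
apply; rewrite cardsU1 niX addnCA add1n -addSn leq_add2r.
apply: card_embed_lt; first exact: subsetUr.
by apply/subsetPn; exists i => //; rewrite !inE eqxx.
Qed.

Lemma card_embed (X : {set 'I_m}) : #|f X| + #|X| = m.+1.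
Proof. by apply/eqP; rewrite eqn_leq card_embed_addl card_embed_addr. Qed.

Lemma embed0 : f set0 = components set0.
Proof.
apply/esym/finer_card_eq => //; first exact: finer_components0.
by rewrite card_components0 cardV -(card_embed set0) cards0 addn0.
Qed.

(** Some two points share a block of [f [set i]], since otherwise it would refine [f set0]. Joining
    just these two points already gives [m] blocks, as many as [f [set i]] has, so nothing else is
    joined. *)
Lemma embed1 (i : 'I_m) :
  exists2 e : {set V}, #|e| = 2 & f [set i] = components [set e].
Proof.
have [/existsP[x /existsP[y /andP[xy yx]]]|H] :=
  boolP [exists x, [exists y, (x != y) && (y \in pblock (f [set i]) x)]].
  exists [set x; y]; first by rewrite cards2 xy.
  apply/esym/finer_card_eq => //; first exact: pair_finer.
  have := @card_components_add set0 x y; rewrite setU0 card_components0 cardV.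
  rewrite -(card_embed [set i]) cards1 addn1 => H; rewrite -ltnS -H //.
  by apply: contra xy => cxy; rewrite eq_sym -in_set1 -component0 inE.
suff /f_finer/subsetP/(_ i) : finer (f [set i]) (f set0) by rewrite !inE eqxx => /(_ isT).
rewrite embed0; apply: pblock_finer => // x y yx.
rewrite pblock_components component0 inE; apply: contraNT H => xy.
by apply/existsP; exists x; apply/existsP; exists y; rewrite eq_sym xy.
Qed.

(* If the endpoints of [e i] were already connected by [e @: Y], then
   [f [set i]] would be finer than [f Y], forcing [i \in Y]. *)
Lemma embed_components : exists e : 'I_m -> {set V},
  [/\ injective e, forall i, #|e i| = 2 & forall X, f X = components (e @: X)].
Proof.
have [e e2 ef] := fin_all_exists2 embed1; exists e; split=> //.
  move=> i j eij; apply/set1P; rewrite -sub1set; apply/f_finer.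
  by rewrite !ef eij; apply: finer_refl.
move=> X; have [k] := ubnP #|X|; elim: k X => // k IHk X leXk.
have [->|/set0Pn[i iX]] := eqVneq X set0; first by rewrite imset0 embed0.
set Y := X :\ i.
have fY : f Y = components (e @: Y).
  by apply: IHk; move: leXk; rewrite (cardsD1 i) iX.
have [/eqP/cards2P[x [y [xy exy]]]] := e2 i.
apply/esym/finer_card_eq => //.
  apply/components_finer => // u v /imsetP[j jX uv].
  have : finer (f [set j]) (f X) by apply/f_finer; rewrite sub1set.
  by rewrite ef => /components_finer; apply => //; rewrite /adj uv inE.
have nc : ~~ connect (adj (e @: Y)) x y.
  apply/negP=> cxy; suff /f_finer : finer (f [set i]) (f Y).
    by rewrite sub1set !inE eqxx.
  by rewrite ef exy; apply: pair_finer => //; rewrite fY pblock_components inE.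
(* Adding the edge [e i] loses exactly one component, and passing from [f Y] to [f X] loses exactly
   one block, so the counts agree. *)
have := card_components_add nc.
rewrite -exy -imsetU1 setD1K // -fY => cY.
have := card_embed X; rewrite -(card_embed Y) cY (cardsD1 i X) iX.
by rewrite addnA addn1 => /addIn [->].
Qed.

End BooleanEmbedding.

(** Each [e i] is a bridge: if the other edges joined its ends, order reflection would place [i] in
    the complement of [[set i]]. A forest with [m] edges on [m.+1] vertices has a single
    component. *)
Lemma embed_tree m (e : 'I_m -> {set V}) : #|V| = m.+1 -> injective e ->
  (forall i, #|e i| = 2) ->
  (forall X Y : {set 'I_m}, X \subset Y <->
     finer (components (e @: X)) (components (e @: Y))) ->
  is_tree [set: V] (e @: [set: 'I_m]).
Proof.
move=> cardV e_inj e2 e_finer; set E := e @: _.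
have gE : is_graph [set: V] E by move=> _ /imsetP[i _ ->]; rewrite subsetT.
have bE : bridged E.
  move=> x y /imsetP[i _ exy]; apply/negP=> cxy.
  suff /e_finer : finer (components (e @: [set i])) (components (e @: (~: [set i]))).
    by rewrite sub1set !inE eqxx.
  rewrite imset_set1 -exy; apply: pair_finer => //.
  rewrite pblock_components inE; apply: connect_adjS cxy; rewrite exy.
  apply/subsetP=> e0 /setD1P[eij /imsetP[j _ ej]]; rewrite ej in eij *.
  by apply: imset_f; rewrite !inE; apply: contraNneq eij => ->.
have E1 : #|components E| = 1.
  have := card_bridged gE bE; rewrite (card_imset _ e_inj) cardsT card_ord cardV.
  by rewrite -add1n => /addIn.
have [x0 _] : exists x : V, x \in V by apply/card_gt0P; rewrite cardV.
split; first by split=> //; apply/acyclicP.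
  by apply/set0Pn; exists x0.
move=> x y _ _; have /eqP/cards1P[B EB] := E1.
have BE z : component E z = B by apply/set1P; rewrite -EB mem_components.
by have := mem_component E y; rewrite BE -(BE x) inE.
Qed.

Definition subforests E : {set {set {set V}}} :=
  [set components F | F in powerset E].

Lemma mem_component1 e x y : y \in component [set e] x -> (y == x) || (y \in e).
Proof.
rewrite inE.
apply: (connect_inv (Q := fun y => is_true ((y == x) || (y \in e)))).
  by rewrite eqxx.
move=> u v _; rewrite /adj inE => /eqP <-.
by rewrite !inE eqxx !orbT.
Qed.

(** The partition joining only the ends of an edge [e] of [E] must come from some [F] inside [E'].
    This [F] is nonempty, and any edge of it lies in a nontrivial block, hence equals [e]. *)
Lemma subforests_eq_subset E E' : is_tree [set: V] E -> is_tree [set: V] E' ->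
  subforests E = subforests E' -> E \subset E'.
Proof.
move=> [[gE /(acyclicP gE) bE] _ _] [[gE' /(acyclicP gE') bE'] _ _] EE'.
apply/subsetP=> e eE; have [/eqP/cards2P[x [y [xy exy]]] _] := gE _ eE.
have : components [set e] \in subforests E.
  by apply: imset_f; rewrite powersetE sub1set.
rewrite EE' => /imsetP[F]; rewrite powersetE => FE' eF.
have [F0|/set0Pn[e' e'F]] := eqVneq F set0.
  have : y \in component [set e] x.
    by rewrite inE connect1 // /adj -exy inE.
  by rewrite -pblock_components eF F0 pblock_components component0 inE eq_sym
    (negbTE xy).
suff <- : e' = e by apply: (subsetP FE').
have [/eqP/cards2P[u [v [uv e'uv]]] _] := gE' _ (subsetP FE' _ e'F).
have : v \in component [set e] u.
  rewrite -pblock_components eF pblock_components inE connect1 //.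
  by rewrite /adj -e'uv.
have : u \in component [set e] v.
  rewrite -pblock_components eF pblock_components inE connect1 //.
  by rewrite adj_sym /adj -e'uv.
move=> /(mem_component1 (e := e)); rewrite (negbTE uv) /= => ue.
move=> /(mem_component1 (e := e)); rewrite eq_sym (negbTE uv) /= => ve.
apply/eqP; rewrite eqEcard e'uv subUset !sub1set ue ve /=.
by rewrite exy !cards2 uv xy.
Qed.

End Components.

(** * Convex hulls of finite planar sets *)

Section Convexity.
Import Order.TTheory GRing.Theory Num.Theory.
Variable R : realType.
Local Notation plane := 'rV[R]_2.
Implicit Types (A C : set plane) (x y z : plane) (t : R).

Lemma convex_setP C : convex_set C <->
  (forall x y t, C x -> C y -> 0 <= t -> t <= 1 -> C (t *: x + (1 - t) *: y)).
Proof.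
split=> [cC x y t Cx Cy t0 t1|cC x y t].
  by have := cC x y (Itv01 t0 t1); rewrite !inE; apply.
by rewrite !inE => Cx Cy; apply: cC.
Qed.

Lemma convex_conv_hull A x y t : conv_hull A x -> conv_hull A y ->
  0 <= t -> t <= 1 -> conv_hull A (t *: x + (1 - t) *: y).
Proof.
move=> Ax Ay t0 t1 C [cC AC]; apply: (convex_setP C).1 => //.
- exact: Ax.
- exact: Ay.
Qed.

Lemma sub_conv_hull A : A `<=` conv_hull A.
Proof. exact: sub_gen_smallest. Qed.

Lemma conv_hull_sub A C : (forall x y t, C x -> C y -> 0 <= t -> t <= 1 ->
  C (t *: x + (1 - t) *: y)) -> A `<=` C -> conv_hull A `<=` C.
Proof. by move=> cC; apply: smallest_sub; apply/convex_setP. Qed.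

Lemma conv_hull_subset A C : A `<=` conv_hull C -> conv_hull A `<=` conv_hull C.
Proof. by apply: conv_hull_sub => x y t; apply: convex_conv_hull. Qed.

Lemma conv_hull_mono A C : A `<=` C -> conv_hull A `<=` conv_hull C.
Proof. by move=> AC; apply: conv_hull_subset => x /AC; apply: sub_conv_hull. Qed.

(** The weights are not normalised, which lets the induction on [s] run through partial sums.
    Nonemptiness of [C] supplies [c] when all weights so far are zero. *)
Lemma convex_sum (I : Type) (C : set plane) (s : seq I) (w : I -> R)
    (x : I -> plane) :
  (forall x y t, C x -> C y -> 0 <= t -> t <= 1 -> C (t *: x + (1 - t) *: y)) ->
  C !=set0 -> (forall i, 0 <= w i) -> (forall i, w i != 0 -> C (x i)) ->
  exists2 c, C c & \sum_(i <- s) w i *: x i = (\sum_(i <- s) w i) *: c.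
Proof.
move=> cC [c0 Cc0] w0 Cx; elim: s => [|i s [c Cc IHs]].
  by exists c0; rewrite // !big_nil scale0r.
rewrite !big_cons IHs; set W := \sum_(j <- s) w j.
have W0 : 0 <= W by apply: sumr_ge0.
have [wi0|wi0] := eqVneq (w i) 0.
  by exists c => //; rewrite wi0 scale0r !add0r.
have wp : 0 < w i by rewrite lt_neqAle eq_sym wi0 w0.
have sp : 0 < w i + W by rewrite ltr_wpDr.
exists ((w i / (w i + W)) *: x i + (1 - w i / (w i + W)) *: c).
  apply: cC => //; first exact: Cx.
  - by rewrite divr_ge0 // ltW.
  - by rewrite ler_pdivrMr // mul1r lerDl.
rewrite scalerDr !scalerA; congr (_ *: _ + _ *: _); field; exact: lt0r_neq0.
Qed.

Section FinitePoints.
Variable P : {fset plane}.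
Implicit Types (S T : {set P}) (p q : P) (w : P -> R).

Definition weighted_sum w : plane := \sum_p w p *: val p.

(** The weights are functions on all of [P] vanishing off [S], so weights for different subsets can
    be subtracted from each other. *)
Lemma conv_hull_points S z : conv_hull (points S) z <->
  exists w, [/\ forall p, 0 <= w p, forall p, p \notin S -> w p = 0,
                \sum_p w p = 1 & z = weighted_sum w].
Proof.
split.
  move: z; apply: conv_hull_sub.
    move=> x y t [u [u0 uS u1 ->]] [v [v0 vS v1 ->]] t0 t1.
    exists (fun p => t * u p + (1 - t) * v p); split.
    - by move=> p; rewrite addr_ge0 // mulr_ge0 // subr_ge0.
    - by move=> p pS; rewrite uS // vS // !mulr0 addr0.
    - by rewrite big_split /= -!mulr_sumr u1 v1; ring.
    - rewrite /weighted_sum !scaler_sumr -big_split /=.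
      by apply: eq_bigr => p _; rewrite !scalerA -scalerDl.
  move=> _ [p /= pS <-]; exists (fun q => (q == p)%:R); split.
  - by move=> q; rewrite ler0n.
  - by move=> q; apply: contraNeq; rewrite pnatr_eq0 eqb0 negbK => /eqP->.
  - by rewrite (bigD1 p) //= eqxx big1 ?addr0 // => q /negbTE ->.
  - rewrite /weighted_sum (bigD1 p) //= eqxx scale1r big1 ?addr0 // => q qp.
    by rewrite (negbTE qp) scale0r.
case=> w [w0 wS w1 ->].
have Cw p : w p != 0 -> conv_hull (points S) (val p).
  move=> wp; apply: sub_conv_hull; exists p => //=.
  by apply: contraNT wp => /wS ->.
have Sn0 : conv_hull (points S) !=set0.
  have [p /Cw Cp] : exists p, w p != 0.
    apply/existsP; apply: contra_eqT w1 => /existsPn w0'.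
    rewrite big1 1?eq_sym ?oner_eq0 // => p _.
    by apply/eqP; rewrite -[_ == _]negbK w0'.
  by exists (val p).
have [c Cc] := convex_sum (index_enum P) (@convex_conv_hull (points S)) Sn0 w0 Cw.
by rewrite w1 scale1r /weighted_sum => ->.
Qed.

Lemma conv_hull_pair p q z : conv_hull (points [set p; q]%SET) z ->
  exists t, [/\ 0 <= t, t <= 1 & z = t *: val p + (1 - t) *: val q].
Proof.
move: z; apply: conv_hull_sub => [x y t [u [u0 u1 ->]] [v [v0 v1 ->]] t0 t1|].
  exists (t * u + (1 - t) * v); split; [nra|nra|].
  rewrite !scalerDr !scalerA addrACA -!scalerDl; congr (_ + _ *: _).
  ring.
move=> _ [r /= + <-]; rewrite !inE => /pred2P[] ->.
  by exists 1; rewrite subrr scale0r scale1r addr0.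
by exists 0; rewrite subr0 scale0r scale1r add0r.
Qed.

End FinitePoints.
End Convexity.

(** * Kirchberger's theorem in the plane: how two hulls of disjoint sets can meet *)

Section Separation.
Import mathcomp.boot.fintype mathcomp.boot.finset.
Import Order.TTheory GRing.Theory Num.Theory.
Local Open Scope set_scope.
Local Open Scope bool_scope.
Variable R : realType.
Local Notation plane := 'rV[R]_2.
Variable P : {fset plane}.
Implicit Types (S T D : {set P}) (p q : P) (w u : P -> R).

(* A point common to the hulls of the disjoint sets [S] and [T] is encoded by
   the difference of its barycentric weights over [S] and over [T]. *)
Definition radon_weight S T w : Prop :=
  [/\ forall p, p \in S -> 0 <= w p, forall p, p \in T -> w p <= 0,
      forall p, p \notin S :|: T -> w p = 0 &
      [/\ \sum_p w p = 0, \sum_(p in S) w p = 1 & weighted_sum w = 0]].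

Definition wsupport w : {set P} := [set p | w p != 0].

Lemma radon_weight_ex S T z : [disjoint S & T] ->
  conv_hull (points S) z -> conv_hull (points T) z ->
  exists w, radon_weight S T w.
Proof.
move=> dST /conv_hull_points[u [u0 uS u1 ->]] /conv_hull_points[v [v0 vT v1 uv]].
exists (fun p => u p - v p); split.
- by move=> p pS; rewrite vT ?subr0 // (disjointFr dST pS).
- move=> p pT; rewrite uS ?sub0r ?oppr_le0 //.
  by rewrite (disjointFl dST pT).
- by move=> p; rewrite inE negb_or => /andP[/uS-> /vT->]; rewrite subr0.
split.
- by rewrite sumrB u1 v1 subrr.
- rewrite -u1 [RHS](bigID (mem S)) /= [X in _ + X]big1 ?addr0; last first.
    by move=> p /uS.
  by apply: eq_bigr => p pS; rewrite vT ?subr0 // (disjointFr dST pS).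
- rewrite /weighted_sum; under eq_bigr do rewrite scalerBl.
  rewrite sumrB -/(weighted_sum u) -/(weighted_sum v) uv.
  by rewrite -/(weighted_sum v) subrr.
Qed.

Lemma radon_weightN S T w : [disjoint S & T] ->
  radon_weight S T w -> radon_weight T S (fun p => - w p).
Proof.
move=> dST [wS wT w0 [w1 wS1 ws]]; split.
- by move=> p /wT; rewrite oppr_ge0.
- by move=> p /wS; rewrite oppr_le0.
- by move=> p; rewrite setUC => /w0 ->; rewrite oppr0.
split; first by rewrite sumrN w1 oppr0.
- have : \sum_p w p = \sum_(p in S) w p + \sum_(p in T) w p.
    rewrite [LHS](bigID (mem S)) /=; congr (_ + _).
    rewrite [LHS](bigID (mem T)) /= [X in _ + X]big1 ?addr0; last first.
      by move=> p /andP[pS pT]; rewrite w0 // inE negb_or pS pT.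
    by apply: eq_bigl => p; rewrite andb_idl // => /(disjointFl dST) ->.
  by rewrite sumrN w1 wS1 => /esym/eqP; rewrite addr_eq0 => /eqP <-.
- rewrite /weighted_sum; under eq_bigr do rewrite scaleNr.
  by rewrite sumrN -/(weighted_sum w) ws oppr0.
Qed.

(** Four linear conditions are imposed on more than four unknowns: the total sum, the sum over [S]
    and the two coordinates. Fixing the sum over [S] preserves the normalisation when a Radon weight
    is moved along [u]. *)
Lemma affine_dependency S D : (4 < #|D|)%N ->
  exists u, [/\ exists p, u p != 0, forall p, p \notin D -> u p = 0,
    \sum_p u p = 0, \sum_(p in S) u p = 0 & weighted_sum u = 0].
Proof.
move=> D4.
pose col p (j : 'I_4) : R := match val j with
  | 0 => 1 | 1 => (p \in S)%:R | 2 => val p 0 0 | _ => val p 0 1 end.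
pose M := \matrix_(i < #|D|, j < 4) col (enum_val i) j.
have /rowV0Pn[u /sub_kermxP uM u0] : kermx M != 0.
  rewrite kermx_eq0 /row_free neq_ltn; apply/orP; left.
  exact: leq_ltn_trans (rank_leq_col M) D4.
have [p0 p0D] : exists p, p \in D by apply/card_gt0P; apply: ltn_trans D4.
pose U p := if p \in D then u 0 (enum_rank_in p0D p) else 0.
have UE i : U (enum_val i) = u 0 i by rewrite /U enum_valP enum_valK_in.
have sumU j : \sum_p U p * col p j = 0.
  transitivity (\sum_(p in D) U p * col p j).
    by rewrite [LHS](bigID (mem D)) /= [X in _ + X]big1 ?addr0 // => p pD;
      rewrite /U (negbTE pD) mul0r.
  transitivity ((u *m M) 0 j); last by rewrite uM mxE.
  rewrite mxE big_enum_val /=; apply: eq_bigr => i _.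
  by rewrite UE mxE.
exists U; split.
- have [i ui] : exists i, u 0 i != 0.
    apply/existsP; apply: contraNT u0 => /existsPn u0.
    by apply/eqP/rowP=> i; rewrite mxE; apply/eqP; have := u0 i; rewrite negbK.
  by exists (enum_val i); rewrite UE.
- by move=> p pD; rewrite /U (negbTE pD).
- by rewrite -[RHS](sumU 0); apply: eq_bigr => p _; rewrite mulr1.
- rewrite -[RHS](sumU 1) big_mkcond; apply: eq_bigr => p _ /=.
  by rewrite /col /=; case: (p \in S); rewrite ?mulr1 ?mulr0.
- apply/rowP=> i; rewrite /weighted_sum summxE mxE.
  have [->|->] : i = 0 \/ i = 1.
    by case: i => [[|[|//]] ?]; [left|right]; apply/val_inj.
  + by rewrite -[RHS](sumU 2); apply: eq_bigr => p _; rewrite mxE.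
  + by rewrite -[RHS](sumU 3); apply: eq_bigr => p _; rewrite mxE.
Qed.

(** As in Carathéodory's theorem, [w] is moved along an affine dependency until a first weight
    vanishes; no weight changes sign before that. *)
Lemma radon_weight_step S T w : radon_weight S T w -> (4 < #|wsupport w|)%N ->
  exists2 w', radon_weight S T w' & (#|wsupport w'| < #|wsupport w|)%N.
Proof.
move=> [wS wT w0 [w1 wS1 ws]] D4.
(* Up to replacing [u] by its opposite, [u] and [w] have the same sign somewhere. *)
have [u [u0 uD u1 uS1 us]] : exists u, [/\ exists p, 0 < u p * w p,
    forall p, p \notin wsupport w -> u p = 0,
    \sum_p u p = 0, \sum_(p in S) u p = 0 & weighted_sum u = 0].
  have [u [[p up] uD u1 uS1 us]] := affine_dependency S D4.
  have wp : w p != 0 by apply: contraNneq up => wp; rewrite uD // inE wp eqxx.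
  have [uw|uw] := ltP 0 (u p * w p); first by exists u; split=> //; exists p.
  exists (fun q => - u q); split.
  - exists p; rewrite mulNr oppr_gt0 lt_neqAle uw andbT.
    by rewrite mulf_neq0.
  - by move=> q /uD ->; rewrite oppr0.
  - by rewrite sumrN u1 oppr0.
  - by rewrite sumrN uS1 oppr0.
  - rewrite /weighted_sum; under eq_bigr do rewrite scaleNr.
    by rewrite sumrN -/(weighted_sum u) us oppr0.
case: u0 => p0 up0.
(* In [w - t u] only the weights where [u] and [w] agree in sign move towards zero; the smallest
   ratio is the time of the first to arrive. *)
have [p up tmin] := @arg_minP _ _ _ p0 (fun p => 0 < u p * w p)
  (fun p => w p / u p) up0.
set t := w p / u p in tmin.
have upn0 : u p != 0 by apply: contraTneq up => ->; rewrite mul0r ltxx.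
have wpn0 : w p != 0 by apply: contraTneq up => ->; rewrite mulr0 ltxx.
have t0 : 0 < t.
  have -> : t = (u p * w p) / (u p ^+ 2) by rewrite /t; field.
  by rewrite divr_gt0 // exprn_even_gt0.
exists (fun q => w q - t * u q); last first.
  apply: proper_card; apply/properP; split.
    apply/subsetP=> q; rewrite !inE; apply: contraNneq => wq.
    by rewrite wq uD ?mulr0 ?subr0 // inE wq eqxx.
  exists p; rewrite inE //.
  by rewrite /t divfK // subrr eqxx.
split.
- move=> q qS; have wq := wS q qS; have [uq|uq] := ltP 0 (u q).
    have wqp : 0 < w q.
      rewrite lt_neqAle wq andbT eq_sym; apply: contraTneq uq => wq0.
      by rewrite uD ?ltxx // inE wq0 eqxx.
    have := tmin q (mulr_gt0 uq wqp); rewrite ler_pdivlMr // => tq.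
    by rewrite subr_ge0.
  rewrite subr_ge0; apply: le_trans wq.
  by rewrite mulr_ge0_le0 // ltW.
- move=> q qT; have wq := wT q qT; have [uq|uq] := ltP (u q) 0.
    have wqp : w q < 0.
      rewrite lt_neqAle wq andbT; apply: contraTneq uq => wq0.
      by rewrite uD ?ltxx // inE wq0 eqxx.
    have uw : 0 < u q * w q by rewrite nmulr_rgt0.
    have := tmin q uw; rewrite ler_ndivlMr // => tq.
    by rewrite subr_le0.
  rewrite subr_le0; apply: le_trans wq _.
  by rewrite mulr_ge0 // ltW.
- move=> q qST; rewrite w0 // uD ?mulr0 ?subr0 // inE negbK.
  by rewrite w0.
split.
- by rewrite sumrB -mulr_sumr w1 u1 mulr0 subr0.
- by rewrite sumrB -mulr_sumr wS1 uS1 mulr0 subr0.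
- rewrite /weighted_sum; under eq_bigr do rewrite scalerBl -scalerA.
  by rewrite sumrB -scaler_sumr -/(weighted_sum u) -/(weighted_sum w) us ws
    scaler0 subr0.
Qed.

Lemma radon_weight_small S T w : radon_weight S T w ->
  exists2 w', radon_weight S T w' & (#|wsupport w'| <= 4)%N.
Proof.
have [k] := ubnP #|wsupport w|; elim: k w => // k IHk w lek wST.
have [le4|gt4] := leqP #|wsupport w| 4; first by exists w.
have [w' w'ST lt] := radon_weight_step wST gt4.
by apply: IHk w'ST; apply: leq_trans lt _.
Qed.

Definition crosses (a a' b b' : plane) : Prop := exists s t : R,
  [/\ 0 < s < 1, 0 < t < 1 &
      s *: a + (1 - s) *: a' = t *: b + (1 - t) *: b'].

Lemma big_wsupport S T w (F : P -> plane) : [disjoint S & T] ->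
  radon_weight S T w -> \sum_p w p *: F p =
  \sum_(p in wsupport w :&: S) w p *: F p + \sum_(p in wsupport w :&: T) w p *: F p.
Proof.
move=> dST [_ _ w0 _]; rewrite [LHS](bigID (mem S)) /=; congr (_ + _).
  rewrite [LHS](bigID (mem (wsupport w))) /= [X in _ + X]big1 ?addr0.
    by apply: eq_bigl => p; rewrite in_setI andbC.
  by move=> p; rewrite inE negbK => /andP[_ /eqP->]; rewrite scale0r.
rewrite [LHS](bigID (mem (wsupport w :&: T))) /= [X in _ + X]big1 ?addr0.
  apply: eq_bigl => p; rewrite !inE andb_idl // => /andP[_ pT].
  by rewrite (disjointFl dST pT).
move=> p /andP[pS]; rewrite !inE negb_and negbK => /orP[/eqP->|pT].
  by rewrite scale0r.
by rewrite w0 ?scale0r // inE negb_or pS pT.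
Qed.

Lemma sum_wsupport S w : \sum_(p in S) w p = \sum_(p in wsupport w :&: S) w p.
Proof.
rewrite [LHS](bigID (mem (wsupport w))) /= [X in _ + X]big1 ?addr0.
  by apply: eq_bigl => p; rewrite in_setI andbC.
by move=> p; rewrite inE negbK => /andP[_ /eqP->].
Qed.

Lemma radon_weight_neg S T w : [disjoint S & T] -> radon_weight S T w ->
  \sum_(p in T) w p = -1.
Proof.
move=> dST /(radon_weightN dST)[_ _ _ [_ + _]]; rewrite sumrN => /eqP.
by rewrite eqr_oppLR => /eqP.
Qed.

(** The only nonzero weight over [S] is then 1, so the vanishing weighted sum expresses [a] by the
    negated weights over [T]. *)
Lemma radon_weight1 S T w a : [disjoint S & T] -> radon_weight S T w ->
  wsupport w :&: S = [set a] -> conv_hull (points T) (val a).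
Proof.
move=> dST wST wa; have [wS wT w0 [w1 wS1 ws]] := wST.
have wa1 : w a = 1 by move: wS1; rewrite sum_wsupport wa big_set1.
apply/conv_hull_points; exists (fun p => if p \in T then - w p else 0); split.
- by move=> p; case: ifP => // /wT; rewrite oppr_ge0.
- by move=> p /negbTE ->.
- by rewrite -big_mkcond sumrN (radon_weight_neg dST wST) opprK.
- move: ws; rewrite /weighted_sum (big_wsupport _ dST wST) wa big_set1 wa1.
  rewrite scale1r => /eqP; rewrite addr_eq0 => /eqP ->.
  rewrite -sumrN big_mkcond; apply: eq_bigr => p _.
  rewrite !inE andbC; case: (p \in T); rewrite ?scale0r //=.
  by rewrite scaleNr; case: eqP => // ->; rewrite scale0r oppr0.
Qed.

(** A Radon weight with at most four support points has some on each side. Either one side has a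
    single point, which lies in the other hull, or the points split two and two. *)
Lemma meeting_hulls S T z : [disjoint S & T] ->
  conv_hull (points S) z -> conv_hull (points T) z ->
  [\/ exists2 a, a \in S & conv_hull (points T) (val a),
      exists2 b, b \in T & conv_hull (points S) (val b) |
      exists a a' b b', [/\ a \in S, a' \in S, b \in T, b' \in T &
        crosses (val a) (val a') (val b) (val b')]].
Proof.
move=> dST Sz Tz; have [w0 /radon_weight_small[w wST w4]] := radon_weight_ex dST Sz Tz.
have dTS : [disjoint T & S] by rewrite disjoint_sym.
have wTS := radon_weightN dST wST.
have suppN : wsupport (fun p => - w p) = wsupport w.
  by apply/setP=> p; rewrite !inE oppr_eq0.
have [wS wT w00 [w1 wS1 ws]] := wST.
have wT1 := radon_weight_neg dST wST.
set A := wsupport w :&: S; set B := wsupport w :&: T.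
have A0 : A != set0.
  apply/eqP=> A0; move: wS1; rewrite sum_wsupport -/A A0 big_set0 => /esym/eqP.
  by rewrite oner_eq0.
have B0 : B != set0.
  apply/eqP=> B0; move: wT1; rewrite sum_wsupport -/B B0 big_set0 => /esym/eqP.
  by rewrite oppr_eq0 oner_eq0.
have AB : (#|A| + #|B| <= 4)%N.
  apply: leq_trans w4; rewrite -cardsUI [A :&: B](_ : _ = set0) ?cards0 ?addn0.
    by apply: subset_leq_card; rewrite subUset !subsetIl.
  by apply/setP=> p; rewrite !inE; case: (boolP (p \in S)) => [/(disjointFr dST)->|];
    rewrite ?andbF.
have [/cards1P[a Aa]|A1] := boolP (#|A| == 1%N).
  apply: Or31; exists a; last exact: radon_weight1 wST Aa.
  by have : a \in A; [rewrite Aa set11 | rewrite inE => /andP[]].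
have [/cards1P[b Bb]|B1] := boolP (#|B| == 1%N).
  apply: Or32; exists b; last by apply: radon_weight1 wTS _ => //; rewrite suppN.
  by have : b \in B; [rewrite Bb set11 | rewrite inE => /andP[]].
have [A2 B2] : #|A| = 2 /\ #|B| = 2.
  move: A0 B0 A1 B1 AB; rewrite -!card_gt0.
  by case: #|A| => [|[|[|[|[|?]]]]] //; case: #|B| => [|[|[|[|[|?]]]]].
have /eqP/cards2P[a [a' [aa' Aaa']]] := A2.
have /eqP/cards2P[b [b' [bb' Bbb']]] := B2.
have inA p : p \in A -> p \in S /\ 0 < w p.
  rewrite !inE => /andP[wp pS]; split=> //.
  by rewrite lt_neqAle eq_sym wp wS.
have inB p : p \in B -> p \in T /\ w p < 0.
  rewrite !inE => /andP[wp pT]; split=> //.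
  by rewrite lt_neqAle wp wT.
have [aS wa] := inA a ltac:(by rewrite Aaa' !inE eqxx).
have [a'S wa'] := inA a' ltac:(by rewrite Aaa' !inE eqxx orbT).
have [bT wb] := inB b ltac:(by rewrite Bbb' !inE eqxx).
have [b'T wb'] := inB b' ltac:(by rewrite Bbb' !inE eqxx orbT).
apply: Or33; exists a, a', b, b'; split=> //.
have sumA (Z : nmodType) (F : P -> Z) : \sum_(p in A) F p = F a + F a'.
  by rewrite Aaa' big_setU1 ?inE // big_set1.
have sumB (Z : nmodType) (F : P -> Z) : \sum_(p in B) F p = F b + F b'.
  by rewrite Bbb' big_setU1 ?inE // big_set1.
move: wS1 wT1; rewrite (sum_wsupport S) (sum_wsupport T) sumA sumB => wS1 wT1.
(* The weights at [a] and [a'] sum to 1, those at [b] and [b'] to -1. *)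
exists (w a), (- w b); split; [lra|lra|].
have -> : 1 - w a = w a' by lra.
have -> : 1 - - w b = - w b' by lra.
move: ws; rewrite /weighted_sum (big_wsupport _ dST wST) sumA sumB.
by move=> /eqP; rewrite addr_eq0 => /eqP ->; rewrite !scaleNr opprD.
Qed.

End Separation.

(** * Crossing segments in a hull configuration *)

Section Plane.
Import Order.TTheory GRing.Theory Num.Theory numFieldNormedType.Exports.
Variable R : realType.
Local Notation plane := 'rV[R]_2.
Implicit Types (a b c d p x y z : plane) (A : set plane).

Lemma plane_eq x y : x 0 0 = y 0 0 -> x 0 1 = y 0 1 -> x = y.
Proof.
move=> x0 x1; apply/rowP=> i.
have [->|->] // : i = 0 \/ i = 1.
by case: i => [[|[|//]] ?]; [left|right]; apply/val_inj.
Qed.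

(** Twice the signed area of the triangle [a b p]; its sign tells the side of the line [ab] on which
    [p] lies. *)
Definition orient a b p : R :=
  (b 0 0 - a 0 0) * (p 0 1 - a 0 1) - (b 0 1 - a 0 1) * (p 0 0 - a 0 0).

Lemma orient_swap a b p : orient b a p = - orient a b p.
Proof. rewrite /orient; ring. Qed.

Lemma orient_affine a b x y (t : R) :
  orient a b (t *: x + (1 - t) *: y) = t * orient a b x + (1 - t) * orient a b y.
Proof. rewrite /orient !mxE; ring. Qed.

Lemma orient_line a b (t : R) : orient a b (t *: a + (1 - t) *: b) = 0.
Proof. rewrite /orient !mxE; ring. Qed.

Lemma orient0_line a b p : a != b -> orient a b p = 0 ->
  exists r : R, p = (1 - r) *: a + r *: b.
Proof.
move=> ab oab.
have [e0|n0] := eqVneq (b 0 0 - a 0 0) 0; last first.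
  exists ((p 0 0 - a 0 0) / (b 0 0 - a 0 0)).
  have e1 : p 0 1 - a 0 1 = (b 0 1 - a 0 1) * ((p 0 0 - a 0 0) / (b 0 0 - a 0 0)).
    apply: (mulfI n0); rewrite mulrA mulrCA mulrCA; move: oab; rewrite /orient.
    move=> /eqP; rewrite subr_eq0 => /eqP ->; field.
    by [].
  apply: plane_eq; rewrite !mxE; first by field.
  by apply: (addIr (- a 0 1)); rewrite e1; ring.
have n1 : b 0 1 - a 0 1 != 0.
  apply: contraNneq ab => e1; apply/eqP/plane_eq; lra.
exists ((p 0 1 - a 0 1) / (b 0 1 - a 0 1)).
have e1 : p 0 0 - a 0 0 = 0.
  apply: (mulfI n1); rewrite mulr0; move: oab; rewrite /orient e0; lra.
apply: plane_eq; rewrite !mxE; last by field.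
set k := _ / _; nra.
Qed.

Lemma orient_continuous a b : continuous (orient a b).
Proof.
move=> p; rewrite /orient.
have c (i : 'I_2) : (fun q : plane => q 0 i) @ p --> p 0 i.
  exact: coord_continuous.
have d (i : 'I_2) (k l : R) : (fun q : plane => k * (q 0 i - l)) @ p --> k * (p 0 i - l).
  have e : (fun q : plane => q 0 i - l) @ p --> p 0 i - l.
    by apply: (@cvgB _ R^o plane (nbhs p)) => //; exact: cvg_cst.
  by apply: (@cvgM R plane (nbhs p)) => //; exact: cvg_cst.
exact: (@cvgB _ R^o plane (nbhs p) _ _ _ _ _ (d 1 _ _) (d 0 _ _)).
Qed.

(** The barycentric coordinates of a point are quotients of [orient] values by [orient a b c]. They
    are continuous, so they stay positive near the given point, and points with positive coordinates
    lie in the hull. *)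
Lemma triangle_interior A a b c (l m n : R) :
  conv_hull A a -> conv_hull A b -> conv_hull A c -> orient a b c != 0 ->
  0 < l -> 0 < m -> 0 < n -> l + m + n = 1 ->
  interior (conv_hull A) (l *: a + m *: b + n *: c).
Proof.
move=> Aa Ab Ac D0 l0 m0 n0 lmn; set D := orient a b c in D0 *.
set p0 := _ + n *: c.
have nE : n = 1 - l - m by lra.
have la : orient b c p0 / D = l.
  rewrite /p0 /D /orient !mxE nE; field; move: D0; rewrite /D /orient.
  by apply: contraNneq => <-; apply/eqP; ring.
have mb : orient c a p0 / D = m.
  rewrite /p0 /D /orient !mxE nE; field; move: D0; rewrite /D /orient.
  by apply: contraNneq => <-; apply/eqP; ring.
have nc : orient a b p0 / D = n.
  rewrite /p0 /D /orient !mxE nE; field; move: D0; rewrite /D /orient.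
  by apply: contraNneq => <-; apply/eqP; ring.
have pos u v : 0 < orient u v p0 / D -> \forall p \near p0, 0 < orient u v p / D.
  move=> k0; have cv : (fun p => orient u v p / D) @ p0 --> orient u v p0 / D.
    apply: (@cvgM R plane (nbhs p0)); last exact: cvg_cst.
    exact: orient_continuous.
  exact: (cvgr_gt _ cv).
rewrite /interior /=.
have H1 := pos b c; rewrite la in H1; have {}H1 := H1 l0.
have H2 := pos c a; rewrite mb in H2; have {}H2 := H2 m0.
have H3 := pos a b; rewrite nc in H3; have {}H3 := H3 n0.
apply: filterS3 H1 H2 H3 => p.
set x := orient b c p / D; set y := orient c a p / D; set z := orient a b p / D.
move=> x0 y0 z0.
have xyz : x + y + z = 1.
  by rewrite /x /y /z -!mulrDl -[RHS](divff D0); congr (_ / _); rewrite /D /orient; ring.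
have -> : p = (x + y) *: ((x / (x + y)) *: a + (1 - x / (x + y)) *: b) +
             (1 - (x + y)) *: c.
  have xy : x + y != 0 by apply: lt0r_neq0; lra.
  have -> : 1 - (x + y) = z by lra.
  have -> : 1 - x / (x + y) = y / (x + y) by field.
  rewrite scalerDr !scalerA !(mulrCA (x + y)) divff // !mulr1.
  apply: plane_eq; rewrite !mxE /x /y /z; apply: (mulfI D0);
    rewrite /D /orient; field; move: D0; rewrite /D /orient;
    by apply: contraNneq => <-; apply/eqP; ring.
apply: convex_conv_hull => //; try lra.
apply: convex_conv_hull => //; first by rewrite divr_ge0 //; lra.
by rewrite ler_pdivrMr; lra.
Qed.

Lemma one_dimensional_orient A a b c : one_dimensional A ->
  A a -> A b -> A c -> orient a b c = 0.
Proof.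
move=> [_ [p [v [_ Av]]]] /Av[r _ <-] /Av[s _ <-] /Av[t _ <-].
rewrite /orient !mxE; ring.
Qed.

(** The quotient is the weight of [x] when 0 is written as a convex combination of [x] and [y]. For
    [x = y] it is 0, the inverse of 0 being 0. *)
Lemma ratio01 (x y : R) :
  x <= 0 /\ 0 <= y \/ 0 <= x /\ y <= 0 -> 0 <= y / (y - x) /\ y / (y - x) <= 1.
Proof.
have [->|xy] := eqVneq x y; first by rewrite subrr invr0 mulr0 ler01.
case=> -[x0 y0].
  have d0 : 0 < y - x by rewrite subr_gt0 lt_neqAle xy (le_trans x0).
  by rewrite divr_ge0 ?(ltW d0) // ler_pdivrMr // mul1r lerDl oppr_ge0.
have d0 : 0 < x - y by rewrite subr_gt0 lt_neqAle eq_sym xy (le_trans y0).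
rewrite -[y - x]opprB invrN mulrN -mulNr.
by rewrite divr_ge0 ?oppr_ge0 ?(ltW d0) // ler_pdivrMr // mul1r lerDr.
Qed.

End Plane.

(** * From crossing segments to crossing edges *)

Section Crossing.
Import mathcomp.boot.fintype mathcomp.boot.finset.
Import Order.TTheory GRing.Theory Num.Theory numFieldNormedType.Exports.
Local Open Scope set_scope.
Local Open Scope bool_scope.
Variables (R : realType) (P : {fset 'rV[R]_2}).
Hypothesis hullP : hull_configuration P.
Implicit Types (S T : {set P}) (a b c d : P) (F : {set {set P}}).

Lemma crosses_swap (x x' y y' : 'rV[R]_2) : crosses x x' y y' -> crosses x x' y' y.
Proof.
move=> [s [t [s01 t01 e]]]; exists s, (1 - t); split=> //; first lra.
by rewrite e addrC; congr (_ + _); congr (_ *: _); ring.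
Qed.

Lemma crosses_sym (x x' y y' : 'rV[R]_2) : crosses x x' y y' -> crosses y y' x x'.
Proof. by move=> [s [t [s01 t01 e]]]; exists t, s; split. Qed.

Lemma hull_point (p : P) : conv_hull [set` P] (val p).
Proof. by apply: sub_conv_hull; apply: valP. Qed.

Lemma hull_points S : conv_hull (points S) `<=` conv_hull [set` P].
Proof. by apply: conv_hull_mono => _ [p _ <-]; apply: valP. Qed.

Section Sides.
Variables S T : {set P}.
Hypothesis ST : forall p, p \in S -> ~ conv_hull (points T) (val p).
Hypothesis TS : forall p, p \in T -> ~ conv_hull (points S) (val p).

Lemma hull_segment (U : {set P}) a b (t : R) : a \in U -> b \in U ->
  0 <= t -> t <= 1 -> conv_hull (points U) (t *: val a + (1 - t) *: val b).
Proof.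
move=> aU bU t0 t1; apply: convex_conv_hull => //; apply: sub_conv_hull.
- by exists a.
- by exists b.
Qed.

(** On a common line, [a] and [a'] lie outside the segment [bb'], while the crossing point lies
    inside it. So they are on opposite sides of it and the hull of [S] contains [b], against
    [TS]. *)
Lemma crosses_not_collinear a a' b b' : a \in S -> a' \in S -> b \in T ->
  b' \in T -> crosses (val a) (val a') (val b) (val b') ->
  orient (val b) (val b') (val a) != 0.
Proof.
move=> aS a'S bT b'T [s [t [/andP[s0 s1] /andP[t0 t1] e]]]; apply/eqP=> oa.
have [bb'|bb'] := eqVneq (val b) (val b').
  case: (TS bT); rewrite [val b](_ : _ = t *: val b + (1 - t) *: val b').
    by rewrite -e; apply: hull_segment => //; lra.
  by rewrite -bb' -scalerDl addrC subrK scale1r.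
have oa' : orient (val b) (val b') (val a') = 0.
  have := orient_line (val b) (val b') t; rewrite -e orient_affine oa mulr0 add0r.
  by move=> /eqP; rewrite mulf_eq0 => /orP[|/eqP//]; rewrite subr_eq0 => /eqP; lra.
(* Parameters along the line have [b] at 0 and [b'] at 1, so the crossing point is at [1 - t]. *)
have [r ra] := orient0_line bb' oa; have [r' ra'] := orient0_line bb' oa'.
have rE : s * r + (1 - s) * r' = 1 - t.
  apply/eqP; rewrite -subr_eq0; apply: contraNT bb' => n0.
  have H i : val b 0 i = val b' 0 i.
    apply: (mulfI n0); have := congr1 (fun z : 'rV[R]_2 => z 0 i) e.
    by rewrite ra ra' !mxE => ?; lra.
  by apply/eqP/plane_eq; apply: H.
have out q (c : P) : c \in S -> val c = (1 - q) *: val b + q *: val b' ->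
    q < 0 \/ 1 < q.
  move=> cS cE; have [q0|q0] := ltP q 0; first by left.
  have [q1|q1] := ltP 1 q; first by right.
  by case: (ST cS); rewrite cE -{2}[q](subKr 1); apply: hull_segment;
    rewrite ?subr_ge0 ?gerBl.
have r01 := out r a aS ra; have r'01 := out r' a' a'S ra'.
have rr' : r < 0 /\ 1 < r' \/ 1 < r /\ r' < 0.
  move: r01 r'01 rE s0 s1 t0 t1; clear=> r01 r'01 rE s0 s1 t0 t1.
  by case: r01 => r01; case: r'01 => r'01; [exfalso; nra|left|right|exfalso; nra].
have n0 : r' - r != 0.
  rewrite subr_eq0 neq_lt; case: rr' => -[u v]; apply/orP; [right|left].
    exact: lt_trans u (lt_trans ltr01 v).
  exact: lt_trans v (lt_trans ltr01 u).
case: (TS bT); have -> : val b = (r' / (r' - r)) *: val a + (1 - r' / (r' - r)) *: val a'.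
  by rewrite ra ra'; apply: plane_eq; rewrite !mxE; field.
have [k0 k1] : 0 <= r' / (r' - r) /\ r' / (r' - r) <= 1.
  by apply: ratio01; case: rr' => -[? ?]; [left|right]; split; apply: ltW => //;
    apply: lt_trans ltr01 _.
exact: hull_segment.
Qed.

(* The points of the line [bb'] strictly between its crossing point with [aa']
   and a point [Y] of the hull are interior to the triangle [aa'Y]. *)
Lemma between_interior a a' b b' (s t q r : R) :
  0 < s < 1 -> s *: val a + (1 - s) *: val a' = t *: val b + (1 - t) *: val b' ->
  orient (val b) (val b') (val a) != 0 ->
  conv_hull [set` P] ((1 - r) *: val b + r *: val b') ->
  (1 - t < q < r) || (r < q < 1 - t) ->
  interior (conv_hull [set` P]) ((1 - q) *: val b + q *: val b').
Proof.
move=> /andP[s0 s1] e oa CY btw; set Y := _ + r *: _ in CY.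
have n0 : r - (1 - t) != 0.
  by apply/eqP=> r0; case/orP: btw => /andP[]; lra.
(* The point at parameter [q] is the combination with weight [k] on the crossing point and [1 - k]
   on [Y]. *)
set k := (r - q) / (r - (1 - t)).
have [k0 k1] : 0 < k /\ k < 1.
  rewrite /k; case/orP: btw => /andP[q0 q1].
    by rewrite divr_gt0 ?ltr_pdivrMr; lra.
  rewrite -[r - (1 - t)]opprB -[r - q]opprB invrN mulrNN.
  by rewrite divr_gt0 ?ltr_pdivrMr; lra.
have -> : (1 - q) *: val b + q *: val b' =
    (k * s) *: val a + (k * (1 - s)) *: val a' + (1 - k) *: Y.
  have -> : (k * s) *: val a + (k * (1 - s)) *: val a' =
      k *: (t *: val b + (1 - t) *: val b') by rewrite -e scalerDr !scalerA.
  rewrite /Y /k.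
  by apply: plane_eq; rewrite !mxE; field.
have s1' : 0 < 1 - s by rewrite subr_gt0.
clearbody k.
apply: triangle_interior; rewrite ?mulr_gt0 ?subr_gt0 //;
  try exact: hull_point; last by ring.
have E0 := congr1 (fun z : 'rV[R]_2 => z 0 0) e.
have E1 := congr1 (fun z : 'rV[R]_2 => z 0 1) e.
rewrite !mxE /= in E0 E1.
have sn0 : 1 - s != 0 by apply: lt0r_neq0; lra.
(* The triangle is nondegenerate: [a] is off the line [bb'], and [Y] is on that line but differs
   from the crossing point. *)
have -> : orient (val a) (val a') Y =
    (r - (1 - t)) * orient (val b) (val b') (val a) / (1 - s).
  have a'0 : val a' 0 0 = (t * val b 0 0 + (1 - t) * val b' 0 0 - s * val a 0 0) / (1 - s).
    by rewrite -E0; field.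
  have a'1 : val a' 0 1 = (t * val b 0 1 + (1 - t) * val b' 0 1 - s * val a 0 1) / (1 - s).
    by rewrite -E1; field.
  by rewrite /orient /Y !mxE /= a'0 a'1; field.
by rewrite !mulf_neq0 // invr_eq0.
Qed.

(** The path from [a] to [a'] changes sides of the line [bb'] along some edge [cd], meeting it in
    [Y]. If [Y] were outside the segment [bb'], then [b] or [b'] would lie strictly between [Y] and
    the crossing point, hence in the interior of the hull. *)
Lemma crossing_edge_pos F a a' b b' :
  (forall c d, c \in S -> adj F c d -> d \in S) ->
  connect (adj F) a a' -> a \in S -> a' \in S -> b \in T -> b' \in T ->
  crosses (val a) (val a') (val b) (val b') ->
  0 < orient (val b) (val b') (val a) ->
  exists c d, [/\ c \in S, d \in S, adj F c d &
    crosses (val c) (val d) (val b) (val b')].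
Proof.
move=> FS caa' aS a'S bT b'T.
move=> [s [t [/[dup] s01 /andP[s0 s1] /andP[t0 t1] e]]] oa.
set g := orient (val b) (val b') in oa.
have bb' : val b != val b'.
  by apply: contraTneq oa => bb'; rewrite /g /orient bb' !subrr !mul0r subrr ltxx.
have ga' : g (val a') < 0.
  have := orient_line (val b) (val b') t; rewrite -e orient_affine -/g; nra.
have [c [d [cS cd gc gd]]] : exists c d,
    [/\ c \in S, adj F c d, 0 < g (val c) & g (val d) <= 0].
  apply: contrapT => H.
  have [] : a' \in S /\ 0 < g (val a'); last by lra.
  apply: (connect_inv (Q := fun p : P => p \in S /\ 0 < g (val p))) caa' => //.
  move=> u v [uS gu] uv; split; first exact: FS uv.
  by rewrite ltNge; apply/negP=> gv; apply: H; exists u, v; split.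
have dS := FS _ _ cS cd.
have gcd_gt0 : 0 < g (val c) - g (val d) by rewrite subr_gt0 (le_lt_trans gd).
have gcd0 := lt0r_neq0 gcd_gt0.
(* The zero of the affine function [g] on the segment from [c] to [d], as a weight on [c]. *)
set l := - g (val d) / (g (val c) - g (val d)).
have [l0 l1] : 0 <= l /\ l < 1.
  by rewrite /l divr_ge0 ?oppr_ge0 ?(ltW gcd_gt0) // ltr_pdivrMr // mul1r ltrDr.
set Y := l *: val c + (1 - l) *: val d.
have SY : conv_hull (points S) Y by apply: hull_segment => //; apply: ltW.
have gY : g Y = 0 by rewrite /g orient_affine -/g /l; field.
have [r YE] := orient0_line bb' gY.
have PY : conv_hull [set` P] ((1 - r) *: val b + r *: val b').
  by rewrite -YE; apply: hull_points SY.
(* It is used for [b], at [q = 0], and for [b'], at [q = 1]. In the one-dimensional case [a] would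
   lie on the line [bb'], contrary to [oa]. *)
have inner q (p : P) : val p = (1 - q) *: val b + q *: val b' ->
    ~ ((1 - t < q < r) || (r < q < 1 - t)).
  move=> pE btw; have := between_interior s01 e (lt0r_neq0 oa) PY btw.
  rewrite -pE => pint; case: hullP => [od|/(_ (val p) (valP p))//].
  have := one_dimensional_orient od (hull_point b) (hull_point b') (hull_point a).
  by move/eqP; rewrite -/g gt_eqF.
have r0 : 0 <= r.
  rewrite leNgt; apply/negP=> r0; apply: (inner 0 b); last first.
    by apply/orP; right; rewrite r0 subr_gt0.
  by rewrite subr0 scale1r scale0r addr0.
have r1 : r <= 1.
  rewrite leNgt; apply/negP=> r1; apply: (inner 1 b'); last first.
    by apply/orP; left; rewrite r1 gtrBl t0.
  by rewrite subrr scale1r scale0r add0r.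
have TY : conv_hull (points T) Y.
  by rewrite YE -{2}[r](subKr 1); apply: hull_segment; rewrite ?subr_ge0 ?gerBl.
(* The crossing is proper: at an extreme parameter [Y] would be [d], [b] or [b'], a point of one set
   in the hull of the other. *)
have l_neq0 : l != 0.
  apply/eqP=> l_eq0; apply: (ST dS).
  by move: TY; rewrite /Y l_eq0 scale0r add0r subr0 scale1r.
have r_neq0 : r != 0.
  apply/eqP=> r_eq0; apply: (TS bT).
  by move: SY; rewrite YE r_eq0 subr0 scale1r scale0r addr0.
have r_neq1 : r != 1.
  apply/eqP=> r_eq1; apply: (TS b'T).
  by move: SY; rewrite YE r_eq1 subrr scale1r scale0r add0r.
exists c, d; split=> //; exists l, (1 - r); split.
- by rewrite lt_neqAle eq_sym l_neq0 l0.
- by rewrite subr_gt0 lt_neqAle r_neq1 r1 /= gtrBl lt_neqAle eq_sym r_neq0.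
- by rewrite -/Y YE subKr.
Qed.

Lemma crossing_edge F a a' b b' :
  (forall c d, c \in S -> adj F c d -> d \in S) ->
  connect (adj F) a a' -> a \in S -> a' \in S -> b \in T -> b' \in T ->
  crosses (val a) (val a') (val b) (val b') ->
  exists c d, [/\ c \in S, d \in S, adj F c d &
    crosses (val c) (val d) (val b) (val b')].
Proof.
move=> FS caa' aS a'S bT b'T cr.
have := crosses_not_collinear aS a'S bT b'T cr; rewrite neq_lt => /orP[og|og].
  have og' : 0 < orient (val b') (val b) (val a) by rewrite orient_swap oppr_gt0.
  have [c [d [cS dS cd /crosses_swap cr']]] :=
    crossing_edge_pos FS caa' aS a'S b'T bT (crosses_swap cr) og'.
  by exists c, d; split.
exact: crossing_edge_pos FS caa' aS a'S bT b'T cr og.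
Qed.

End Sides.

End Crossing.

(** * Trees and Boolean subposets *)

Section Correspondence.
Import mathcomp.boot.fintype mathcomp.boot.finset.
Import Order.TTheory GRing.Theory Num.Theory numFieldNormedType.Exports.
Local Open Scope set_scope.
Local Open Scope bool_scope.
Variables (R : realType) (P : {fset 'rV[R]_2}).
Hypothesis hullP : hull_configuration P.
Implicit Types (S T : {set P}) (p x y : P) (E F : {set {set P}}).

(** [crossing_edge] is applied twice, with the roles of [S] and [T] exchanged, to turn crossing
    segments into crossing edges. Edges of [E] meet only at common endpoints, and disjoint trees
    have none. *)
Lemma disjoint_trees_hulls E S T F G : noncrossing_graph E ->
  [disjoint S & T] -> subtree S F E -> subtree T G E ->
  (forall p, p \in S -> ~ conv_hull (points T) (val p)) ->
  (forall p, p \in T -> ~ conv_hull (points S) (val p)) ->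
  (conv_hull (points S) `&` conv_hull (points T) = classical_sets.set0)%classic.
Proof.
move=> [ncE _] dST tS tT ST TS; rewrite -classical_sets.subset0 => z [Sz Tz].
have [[a /ST//]|[b /TS//]|[a [a' [b [b' [aS a'S bT b'T cr]]]]]] :=
  meeting_hulls dST Sz Tz.
have inv (U : {set P}) (H : {set {set P}}) : subtree U H E ->
    (forall c d, c \in U -> adj H c d -> d \in U).
  by move=> [_ [[gH _] _ _]] c d _ /gH[_]; rewrite subUset !sub1set => /andP[].
have [FE [_ _ cS]] := tS; have [GE [_ _ cT]] := tT.
have [c [d [cS' dS cd cr']]] :=
  crossing_edge hullP ST TS (inv _ _ tS) (cS _ _ aS a'S) aS a'S bT b'T cr.
have [u [v [uT vT uv [s [t [/andP[s0 s1] /andP[t0 t1] eq_st]]]]]] :=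
  crossing_edge hullP TS ST (inv _ _ tT) (cT _ _ bT b'T) bT b'T cS' dS (crosses_sym cr').
have cduv : [set c; d] :&: [set u; v] = set0.
  apply/setP=> p; rewrite !inE; apply/negP=> /andP[/pred2P cdp /pred2P uvp].
  have pS : p \in S by case: cdp => ->.
  have : p \in T by case: uvp => ->.
  by rewrite (disjointFr dST pS).
have neq : [set c; d] != [set u; v].
  apply/eqP=> eq; move: cduv; rewrite -eq setIid => /setP/(_ c).
  by rewrite !inE eqxx.
have meet : (edge_segment [set c; d] `&` edge_segment [set u; v])%classic
    (t *: val c + (1 - t) *: val d).
  by split; last rewrite -eq_st; apply: hull_segment; rewrite ?inE ?eqxx ?orbT //;
    apply: ltW.
have [p] := ncE _ _ (subsetP FE _ cd) (subsetP GE _ uv) neq _ meet.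
by rewrite cduv /= inE.
Qed.

(** Each block spans a subtree, so convex geodesics keep the points of one block out of the hull of
    another. *)
Lemma components_noncrossing E F : noncrossing_tree E -> convex_geodesics E ->
  F \subset E -> noncrossing_partition (components F).
Proof.
move=> [[[gE acE] ncE] _] geoE FE; have bE := (acyclicP gE).1 acE.
have pF := components_partition F; split=> // A B AF BF AB.
have dAB : [disjoint A & B].
  by case/and3P: pF => _ /trivIsetP tiF _; apply: tiF.
have block C : C \in components F -> exists G, subtree C G E.
  by case/imsetP=> x _ ->; eexists; apply: component_tree.
have [G tA] := block A AF; have [H tB] := block B BF.
have own C K p : subtree C K E -> conv_hull (points C) (val p) -> p \in C.
  move=> tC Cp; apply: (geoE C K tC); apply: conv_hull_mono Cp => z Cz.
  by left.
apply: (disjoint_trees_hulls ncE dAB tA tB) => p pA /(own _ _ p).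
  by move=> /(_ _ tB); rewrite (disjointFr dAB pA).
by move=> /(_ _ tA); rewrite (disjointFl dAB pA).
Qed.

Lemma subforests_Boolean E : noncrossing_tree E -> convex_geodesics E ->
  Boolean_subposet #|{: P}|.-1 (subforests E).
Proof.
move=> tE geoE; have [_ treeE] := tE; have [[gE acE] _ _] := treeE.
have bE := (acyclicP gE).1 acE.
split=> [pi /imsetP[F]|].
  by rewrite powersetE => FE ->; apply: components_noncrossing FE.
have cE := esym (card_tree treeE).
(* An enumeration of the edges, of which there are [#|{: P}|.-1] by [card_tree]. *)
pose e (i : 'I_#|{: P}|.-1) : {set P} := enum_val (cast_ord cE i).
have eE i : e i \in E by apply: enum_valP.
have e_inj : injective e by move=> i j /enum_val_inj/cast_ord_inj.
have imE (X : {set 'I_#|{: P}|.-1}) : e @: X \subset E.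
  by apply/subsetP=> _ /imsetP[i _ ->].
have fin (X Y : {set 'I_#|{: P}|.-1}) :
    X \subset Y <-> refines (components (e @: X)) (components (e @: Y)).
  split=> [XY|/(bridged_finer gE bE (imE X) (imE Y))/subsetP XY].
    by apply: components_mono; apply: imsetS.
  by apply/subsetP=> i iX; have /XY := imset_f e iX; rewrite mem_imset.
pose f (X : {set 'I_#|{: P}|.-1}) : {set {set P}} := components (e @: X).
exists f; split=> //; split.
- by move=> X _ /=; apply: imset_f; rewrite powersetE.
- move=> X Y _ _ eq; apply/eqP; rewrite eqEsubset.
  by apply/andP; split; apply/fin; rewrite -/(f X) -/(f Y) eq; apply: finer_refl.
- move=> pi /imsetP[F]; rewrite powersetE => FE ->.
  exists (e @^-1: F) => //=; rewrite /f; congr components; apply/setP=> a.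
  apply/imsetP/idP=> [[i + ->]|aF]; first by rewrite inE.
  have aE := subsetP FE _ aF.
  exists (cast_ord (esym cE) (enum_rank_in aE a)); rewrite ?inE /e;
    by rewrite cast_ordKV enum_rankK_in.
Qed.

(** A point outside [S] forms a singleton block of [components F], so the hull of the block [S]
    misses it. *)
Lemma hull_single_out E S F x : subtree S F E ->
  noncrossing_partition (components F) -> conv_hull (points S) (val x) -> x \in S.
Proof.
move=> tS [_ ncF] Sx; apply: contraT => xS.
have [_ [_ /set0Pn[y yS] _]] := tS.
have SF : S \in components F by rewrite -(component_subtree tS yS) mem_components.
have xF : [set x] \in components F.
  by rewrite -(component_subtree_out tS xS) mem_components.
have neq : S != [set x] by apply: contraNneq xS => ->; rewrite set11.
have : (conv_hull (points S) `&` conv_hull (points [set x]))%classic (val x).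
  by split=> //; apply: sub_conv_hull; exists x => //=; rewrite set11.
by rewrite ncF.
Qed.

Lemma conv_hull_drawing S F : is_graph S F ->
  (conv_hull (drawing S F) `<=` conv_hull (points S))%classic.
Proof.
move=> gF; apply: conv_hull_subset => z [Sz|[e eF ez]]; first exact: sub_conv_hull.
have [_ eS] := gF _ eF; apply: conv_hull_mono ez => _ [x xe <-]; exists x => //.
exact: (subsetP eS).
Qed.

Lemma edge_subtree E (x y : P) : x != y -> [set x; y] \in E ->
  subtree [set x; y] [set [set x; y]] E.
Proof.
move=> xy xyE; split; first by rewrite sub1set.
have gF : is_graph [set x; y] [set [set x; y]].
  by move=> e /set1P ->; rewrite cards2 xy.
have gT : is_graph [set: P] [set [set x; y]].
  by move=> e /set1P ->; rewrite cards2 xy subsetT.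
split; first split=> //.
- apply/acyclicP => // u v; rewrite /adj inE => /eqP uv.
  rewrite uv setDv; apply/negP=> cuv.
  have : v \in component set0 u by rewrite inE.
  rewrite component0 inE => /eqP vu; have := cards2 x y.
  by rewrite -uv vu setUid cards1 xy.
- by apply/set0Pn; exists x; rewrite !inE eqxx.
- have cxy : connect (adj [set [set x; y]]) x y by apply: connect1; rewrite /adj inE.
  move=> u v; rewrite !inE => /pred2P[] -> /pred2P[] -> //.
  by rewrite connect_adj_sym.
Qed.

(** The hypothesis is applied to small [F]: the edges of a subtree for convex geodesics, one edge to
    keep other vertices off it, and two edges without a common endpoint, which are then blocks with
    disjoint hulls. Edges sharing an endpoint are reduced to the one-edge case. *)
Lemma noncrossing_components E : is_tree [set: P] E ->
  (forall F, F \subset E -> noncrossing_partition (components F)) ->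
  noncrossing_tree E /\ convex_geodesics E.
Proof.
move=> treeE ncE; have [[gE acE] _ _] := treeE.
have geoE : convex_geodesics E.
  move=> S F tS x Fx; have [FE [[gF _] _ _]] := tS.
  by apply: (hull_single_out tS (ncE F FE)); apply: conv_hull_drawing Fx.
have edge e x : e \in E -> edge_segment e (val x) -> x \in e.
  move=> eE ex; have [/eqP/cards2P[u [v [uv euv]]] _] := gE _ eE.
  rewrite euv in eE ex *; have tE := edge_subtree uv eE.
  by apply: (hull_single_out tE _ ex); apply: ncE; rewrite sub1set.
split=> //; split=> //; split=> //; split=> // e f eE fE ef z [ez fz].
have efE : [set e; f] \subset E by rewrite subUset !sub1set eE.
have [ef0|/set0Pn[x xef]] := eqVneq (e :&: f) set0.
  exfalso.
  have block (g h : {set P}) : g \in E -> h \in E -> g :&: h = set0 ->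
      g \in components [set g; h].
    move=> gE' hE gh0; have [/eqP/cards2P[u [v [uv guv]]] _] := gE _ gE'.
    suff cg : component [set g; h] u = g.
      by have := mem_components [set g; h] u; rewrite cg.
    apply/setP=> w; rewrite [LHS]inE; apply/idP/idP; last first.
      rewrite {1}guv !inE => /pred2P[] -> //; apply: connect1.
      by rewrite /adj -guv !inE eqxx.
    apply: (connect_inv (Q := fun w => w \in g)); first by rewrite guv !inE eqxx.
    move=> p q pg; rewrite /adj !inE => /orP[] /eqP pq.
      by rewrite -pq !inE eqxx orbT.
    have : p \in g :&: h by rewrite inE pg -pq !inE eqxx.
    by rewrite gh0 inE.
  have [_ nc] := ncE _ efE.
  have fb : f \in components [set e; f] by rewrite setUC; apply: block => //; rewrite setIC.
  have : (conv_hull (points e) `&` conv_hull (points f))%classic z by split.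
  by rewrite nc // block.
have other (g : {set P}) : g \in E -> x \in g -> exists2 y, x != y & g = [set x; y].
  move=> gE' xg; have [/eqP/cards2P[u [v [uv guv]]] _] := gE _ gE'.
  move: xg; rewrite guv !inE => /pred2P[] ->; first by exists v.
  by exists u; rewrite 1?eq_sym // setUC.
have [xe xf] : x \in e /\ x \in f by apply/andP; rewrite -in_setI.
have [y xy exy] := other e eE xe; have [y' xy' fxy'] := other f fE xf.
exists x => //; apply: contrapT => zx.
rewrite /edge_segment exy in ez; rewrite /edge_segment fxy' in fz.
have [s [s0 s1 zs]] := conv_hull_pair ez; have [t [t0 t1 zt]] := conv_hull_pair fz.
have zxE (r : R) (w : P) : z = r *: val x + (1 - r) *: val w -> r != 1.
  move=> zr; apply/eqP=> r1; apply: zx.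
  by rewrite zr r1 subrr scale1r scale0r addr0.
have s_lt : s < 1 by rewrite lt_neqAle (zxE s y zs).
have t_lt : t < 1 by rewrite lt_neqAle (zxE t y' zt).
have yy' : y != y' by apply: contraNneq ef => yy'; rewrite exy fxy' yy'.
(* Two edges at [x] with another common point [z] leave [x] in the same direction. The one where [z]
   puts less weight on [x] is no longer than the other, so its far end lies on the other edge. *)
have key (r r' : R) (w w' : P) : 0 <= r -> r <= r' -> r' < 1 ->
    z = r *: val x + (1 - r) *: val w -> z = r' *: val x + (1 - r') *: val w' ->
    conv_hull (points [set x; w']) (val w).
  move=> r0 rr' r'1 zr zr'.
  have r1 : 0 < 1 - r by rewrite subr_gt0 (le_lt_trans rr').
  have -> : val w = ((r' - r) / (1 - r)) *: val x +
                    (1 - (r' - r) / (1 - r)) *: val w'.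
    apply: (scalerI (lt0r_neq0 r1)); rewrite scalerDr !scalerA.
    have -> : (1 - r) *: val w = (r' *: val x + (1 - r') *: val w') - r *: val x.
      by rewrite -zr' zr addrAC subrr add0r.
    rewrite addrAC -scalerBl; congr (_ *: _ + _ *: _); field; exact: lt0r_neq0.
  apply: hull_segment; rewrite ?inE ?eqxx ?orbT //.
    by rewrite divr_ge0 ?subr_ge0 // -subr_ge0 ltW.
  by rewrite ler_pdivrMr // mul1r lerD2r ltW.
have [st|ts] := leP s t.
  have := edge f y fE; rewrite fxy' => /(_ (key s t y y' s0 st t_lt zs zt)).
  by rewrite !inE eq_sym (negbTE xy) (negbTE yy').
have := edge e y' eE; rewrite exy => /(_ (key t s y' y t0 (ltW ts) s_lt zt zs)).
by rewrite !inE eq_sym (negbTE xy') eq_sym (negbTE yy').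
Qed.

Lemma Boolean_subforests (Q : {set {set {set P}}}) : (0 < #|{: P}|)%N ->
  Boolean_subposet #|{: P}|.-1 Q ->
  exists2 E : {set {set P}}, noncrossing_tree E /\ convex_geodesics E & subforests E = Q.
Proof.
move=> P0 [QNC [f [[fQ f_inj f_surj] f_finer]]].
have NCf X : noncrossing_partition (f X) by apply/QNC/fQ.
(* Nonemptiness of [P] enters here: the truncated predecessor is a true one. *)
have cP : #|{: P}| = #|{: P}|.-1.+1 by rewrite prednK.
have [e [e_inj e2 eE]] := embed_components cP (fun X => (NCf X).1) f_finer.
have sub F : F \subset e @: [set: 'I_#|{: P}|.-1] -> exists X : {set 'I_#|{: P}|.-1}, F = e @: X.
  move=> /subsetP FE; exists (e @^-1: F); apply/setP=> a; apply/idP/imsetP.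
    by move=> aF; have /imsetP[i _ ai] := FE _ aF; exists i; rewrite // inE -ai.
  by move=> [i + ->]; rewrite inE.
exists (e @: [set: 'I_#|{: P}|.-1]).
  apply: noncrossing_components.
    apply: embed_tree => // X Y; rewrite -!eE; exact: f_finer.
  by move=> F /sub[X ->]; rewrite -eE.
apply/setP=> pi; apply/imsetP/idP => [[F]|piQ].
  by rewrite powersetE => /sub[X ->] ->; rewrite -eE; apply: fQ.
have [X _ <-] := f_surj _ piQ; exists (e @: X); last exact: eE.
by rewrite powersetE; apply: imsetS; apply: subsetT.
Qed.

End Correspondence.

Theorem theorem3p6 (R : realType) (n : nat) (P : {fset 'rV[R]_2})
    (n_gt0 : (0 < n)%N) (cardP : #|` P| = n) (hullP : hull_configuration P) :
  exists Phi : {set {set P}} -> {set {set {set P}}},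
    set_bij [set E | noncrossing_tree E /\ convex_geodesics E]
            [set Q | Boolean_subposet n.-1 Q] Phi.
Proof.
have cP : #|{: P}| = n by rewrite -cardP cardfE.
exists (@subforests P); rewrite -cP in n_gt0 *; split.
- by move=> E [tE geoE] /=; apply: subforests_Boolean.
- move=> E E' /[!inE] -[[_ tE] _] [[_ tE'] _] EE'.
  by apply/eqP; rewrite finset.eqEsubset !subforests_eq_subset.
- by move=> Q /(Boolean_subforests n_gt0)[E ? <-]; exists E.
Qed.
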